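(* Let $q\ge 1$ be a fixed integer and let $\alpha_1,\alpha_2,\ldots,\alpha_q,\beta$ be positive constants with $\alpha_1+\alpha_2+\cdots+\alpha_q=1$ and $\beta<1/q$. Let $G$ be the random bipartite graph $G_{n,n,p}$ where $p=\frac{\log n+\omega}{n}$, with $\omega=\omega(n)\to\infty$ and $\omega=o(\log n)$. Suppose that the edges of $G$ are independently colored with colors from $C=\{c_1,c_2,\ldots,c_q\}$, where $\mathbb{P}(c(e)=c_i)=\alpha_i$ for $e\in E(G)$, $i\in[q]$. Let $m_1,m_2,\ldots,m_q$ be integers satisfying (i) $m_1+\cdots+m_q=n$ and (ii) $m_i\ge \beta n$ for all $i\in[q]$. Then with high probability there exists a perfect matching $M$ of $G$ in which exactly $m_i$ edges are colored with $c_i$, for each $i=1,2,\ldots,q$.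
   Context: $G_{n,n,p}$ is the random bipartite graph with two vertex classes of size $n$ in which each of the $n^2$ possible edges between the classes is present independently with probability $p$. ''With high probability'' (w.h.p.) means with probability tending to $1$ as $n\to\infty$. $\log$ denotes the natural logarithm. *)

(* Defs.v *)
From HB Require Import structures.
From mathcomp Require Import all_boot all_order all_algebra.
From mathcomp Require Import all_classical all_reals all_analysis.

Set Implicit Arguments.
Unset Strict Implicit.
Unset Printing Implicit Defensive.

Import Order.TTheory GRing.Theory Num.Theory.
Import numFieldNormedType.Exports.

Local Open Scope ring_scope.

(* The vertex classes are two disjoint copies of 'I_n; the pair (x, y) is the
   potential edge joining x in the first class to y in the second. *)
Definition vertex (n : nat) : finType := ('I_n + 'I_n)%type.
Definition edge (n : nat) : finType := ('I_n * 'I_n)%type.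

Definition incident n (v : vertex n) (e : edge n) : bool :=
  match v with
  | inl x => e.1 == x
  | inr y => e.2 == y
  end.

Definition perfect_matching n (E M : {set edge n}) : bool :=
  (M \subset E) && [forall v : vertex n, #|[set e in M | incident v e]| == 1%N].

Definition color_count n q (c : {ffun edge n -> 'I_q}) (M : {set edge n})
    (i : 'I_q) : nat :=
  #|[set e in M | c e == i]|.

(* Probability that G_{n,n,p} has edge set E. *)
Definition gnnp_weight (R : realType) n (p : R) (E : {set edge n}) : R :=
  \prod_(e : edge n) (if e \in E then p else 1 - p).

(* The colors are drawn for all potential edges, independently of each other
   and of the graph; restricted to the edge set E, this is the i.i.d. coloring
   of E with law alpha. Events should only look at the colors of edges in E. *)
Definition coloring_weight (R : realType) n q (alpha : 'I_q -> R)
    (c : {ffun edge n -> 'I_q}) : R :=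
  \prod_(e : edge n) alpha (c e).

Definition colored_gnnp_prob (R : realType) n q (p : R) (alpha : 'I_q -> R)
    (A : {set edge n} -> {ffun edge n -> 'I_q} -> bool) : R :=
  \sum_(E : {set edge n}) \sum_(c : {ffun edge n -> 'I_q} | A E c)
    gnnp_weight p E * coloring_weight alpha c.

Definition has_colored_pm n q (m : 'I_q -> nat)
    (E : {set edge n}) (c : {ffun edge n -> 'I_q}) : bool :=
  [exists M : {set edge n},
    perfect_matching E M && [forall i : 'I_q, color_count c M i == m i]].

Lemma gnnp_weight_sum (R : realType) n (p : R) :
  \sum_(E : {set edge n}) gnnp_weight p E = 1.
Proof.
rewrite /gnnp_weight -bigA_distr.
by apply: big1 => e _; rewrite /= addrC subrK.
Qed.

Lemma coloring_weight_sum (R : realType) n q (alpha : 'I_q -> R) :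
  \sum_(i < q) alpha i = 1 ->
  \sum_(c : {ffun edge n -> 'I_q}) coloring_weight alpha c = 1.
Proof.
move=> alpha1; rewrite /coloring_weight -(bigA_distr_bigA (fun _ : edge n => alpha)).
by apply: big1.
Qed.

Lemma colored_gnnp_probT (R : realType) n q (p : R) (alpha : 'I_q -> R) :
  \sum_(i < q) alpha i = 1 ->
  colored_gnnp_prob (n := n) p alpha (fun _ _ => true) = 1.
Proof.
move=> alpha1; rewrite -(gnnp_weight_sum n p); apply: eq_bigr => E _.
by rewrite -big_distrr /= coloring_weight_sum // mulr1.
Qed.

(* Main.v *)
(** Let [g] be a perfect matching of [G], found by Hall's theorem, and suppose that
    between any two vertex sets of linear size [K] there are edges of every color.
    Give the left vertices target colors [f] with fibre sizes [m i], and look for a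
    perfect matching using at each [x] only edges of color [f x]. If Hall's condition
    fails, linear expansion makes the violator (or the complementary one on the other
    side) small: its vertices are left on their [g]-edges, and [f] is corrected by a
    few transpositions. If the set [Z] of vertices left on [g] reached linear size,
    the violators would add up to a large set with too few neighbours; so the process
    stops and yields a matching with exactly [m i] edges of color [i].

    It remains to see that with high probability [G] has linear expansion in each
    color (union bound over all pairs of sets) and a perfect matching (first moment
    of minimal Hall violators [S], in which every neighbour of [S] is adjacent to at
    least two vertices of [S]). *)

Require Import Defs.
From mathcomp Require Import all_boot all_order all_algebra perm reals zify ring lra.

Set Implicit Arguments.
Unset Strict Implicit.
Unset Printing Implicit Defensive.

Import Order.TTheory GRing.Theory Num.Theory.

(** * Hall's theorem and absorption *)

Definition nbr (T U : finType) (r : T -> U -> bool) (S : {set T}) : {set U} :=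
  [set y | [exists x in S, r x y]].

Lemma nbrP (T U : finType) (r : T -> U -> bool) (S : {set T}) y :
  reflect (exists2 x, x \in S & r x y) (y \in nbr r S).
Proof. by rewrite inE; apply: (iffP exists_inP). Qed.

Lemma nbrS (T U : finType) (r : T -> U -> bool) (S S' : {set T}) :
  S \subset S' -> nbr r S \subset nbr r S'.
Proof.
move=> sSS; apply/subsetP => y /nbrP [x xS rxy].
by apply/nbrP; exists x => //; apply: (subsetP sSS).
Qed.

(** Induction on the size of [A]. A nonempty proper tight set [S] is matched into its neighbours and
    the rest of [A] outside them; without tight sets, any edge at some [x0] can be fixed and its
    ends deleted. [h0] supplies values outside [A]. *)
Lemma Hall (T U : finType) (h0 : T -> U) (r : T -> U -> bool) (A : {set T}) :
    (forall S : {set T}, S \subset A -> #|S| <= #|nbr r S|) ->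
  exists h : T -> U, {in A &, injective h} /\ {in A, forall x, r x (h x)}.
Proof.
move: {2}(#|A|) (leqnn #|A|) => k.
elim: k r A => [|k IH] r A.
  rewrite leqn0 cards_eq0 => /eqP -> _.
  by exists h0; split=> x; rewrite inE.
move=> leA hall.
have [->|[x0 x0A]] := set_0Vmem A; first by exists h0; split=> x; rewrite inE.
case: (boolP [exists S : {set T}, [&& S != set0, S \proper A & #|nbr r S| == #|S|]]).
- case/existsP=> S /and3P [S0 pS /eqP eqS].
  have sSA := proper_sub pS.
  have [||h1 [inj1 r1]] := IH r S.
  + by have := proper_card pS; lia.
  + by move=> S' sS'; apply: hall; apply: subset_trans sSA.
  pose r' x y := r x y && (y \notin nbr r S).
  have [||h2 [inj2 r2]] := IH r' (A :\: S).
  + have := cardsID S A; rewrite (setIidPr sSA).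
    by move: S0; rewrite -card_gt0; lia.
  + move=> S' sS'.
    have disj : [disjoint S & S'].
      rewrite -setI_eq0 -subset0; apply/subsetP => x; rewrite inE => /andP [xS xS'].
      by have := subsetP sS' _ xS'; rewrite inE xS.
    have sU : S :|: S' \subset A.
      by rewrite subUset sSA (subset_trans sS') // subsetDl.
    have := hall _ sU; rewrite cardsU (disjoint_setI0 disj) cards0 subn0.
    have : nbr r (S :|: S') \subset nbr r S :|: nbr r' S'.
      apply/subsetP => y /nbrP [x]; rewrite inE => xSS rxy; rewrite inE.
      case: (boolP (y \in nbr r S)) => //= yS; case/orP: xSS => [xS|xS'].
        by case/negP: yS; apply/nbrP; exists x.
      by apply/nbrP; exists x => //; rewrite /r' rxy.
    move/subset_leq_card; have := (leq_card_setU (nbr r S) (nbr r' S')).1.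
    rewrite eqS; lia.
  exists (fun x => if x \in S then h1 x else h2 x); split.
  + have im1 x : x \in S -> h1 x \in nbr r S.
      by move=> xS; apply/nbrP; exists x => //; apply: r1.
    have im2 x : x \in A -> x \notin S -> h2 x \notin nbr r S.
      by move=> xA xS; have := r2 x; rewrite inE xS xA => /(_ isT) /andP [].
    move=> x y xA yA; case: ifP => xS; case: ifP => yS.
    * exact: inj1.
    * by move=> e; have := im2 y yA (negbT yS); rewrite -e im1.
    * by move=> e; have := im2 x xA (negbT xS); rewrite e im1.
    * by apply: inj2; rewrite inE ?xS ?yS.
  + move=> x xA; case: ifP => xS; first exact: r1.
    by have := r2 x; rewrite inE xS xA => /(_ isT) /andP [].
- move=> noS.
  have : 0 < #|nbr r [set x0]|.
    by have := hall [set x0]; rewrite sub1set x0A cards1 => /(_ isT).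
  case/card_gt0P => y0 /nbrP [x1]; rewrite inE => /eqP -> rxy.
  pose r' x y := r x y && (y != y0).
  have [||h [inj hr]] := IH r' (A :\ x0).
  + by have := cardsD1 x0 A; rewrite x0A; lia.
  + move=> S sS; have [->|S0] := eqVneq S set0; first by rewrite cards0.
    have sSA : S \subset A by rewrite (subset_trans sS) // subsetDl.
    have pS : S \proper A.
      apply/properP; split=> //; exists x0 => //.
      by apply/negP => /(subsetP sS); rewrite !inE eqxx.
    have : #|nbr r S| != #|S|.
      by apply: contra noS => eS; apply/existsP; exists S; rewrite S0 pS.
    have : nbr r S \subset y0 |: nbr r' S.
      apply/subsetP => y /nbrP [x xS rx]; rewrite in_setU1.
      by case: eqP => //= /eqP yy; apply/nbrP; exists x => //; rewrite /r' rx.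
    move/subset_leq_card; rewrite cardsU1.
    by have := hall S sSA; case: (y0 \notin _); lia.
  exists (fun x => if x == x0 then y0 else h x); split.
  + have im x : x \in A -> x != x0 -> h x != y0.
      by move=> xA xx; have := hr x; rewrite !inE xx xA => /(_ isT) /andP [].
    move=> x y xA yA; case: eqP => [->|/eqP xx]; case: eqP => [->|/eqP yy] //.
    * by move=> e; have := im y yA yy; rewrite -e eqxx.
    * by move=> e; have := im x xA xx; rewrite e eqxx.
    * by apply: inj; rewrite !inE ?xx ?yy.
  + move=> x xA; case: eqP => [->|/eqP xx] //.
    by have := hr x; rewrite !inE xx xA => /(_ isT) /andP [].
Qed.

(* The transposition with a vertex already carrying the wanted value keeps all
   fibre sizes. *)
Lemma recolor1 (T I : finType) (f : T -> I) (Z : {set T}) x i :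
    x \notin Z -> #|Z| < #|[set y | f y == i]| ->
  exists x' (f' : T -> I),
    [/\ f' x = i, forall y, y \in Z -> f' y = f y,
        forall y, y != x -> y != x' -> f' y = f y
      & forall j, #|[set y | f' y == j]| = #|[set y | f y == j]|].
Proof.
move=> xZ ltZ; have [fx|fx] := eqVneq (f x) i.
  by exists x, f.
have [x' x'i x'Z] : exists2 x', f x' = i & x' \notin Z.
  have : ~~ ([set y | f y == i] \subset Z).
    by apply/negP => /subset_leq_card; lia.
  by case/subsetPn => y; rewrite inE => /eqP; exists y.
exists x', (f \o tperm x x'); split=> /=.
- by rewrite tpermL.
- by move=> y yZ; rewrite tpermD //; [apply: contraNneq xZ|apply: contraNneq x'Z] => ->.
- by move=> y yx yx'; rewrite tpermD // eq_sym.
- move=> j; rewrite -(card_imset _ (@perm_inj _ (tperm x x'))).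
  apply: eq_card => y; rewrite inE; apply/imsetP/idP.
    by case=> z; rewrite inE /= => /eqP <- ->.
  by move=> fy; exists (tperm x x' y); rewrite ?inE /= tpermK.
Qed.

(** Applies [recolor1] to the vertices of [S] in turn. Fibre sizes never change, so the bound on
    [Z :|: S] always leaves a swap partner outside the vertices already settled; [W] collects the
    partners. *)
Lemma recolor (T I : finType) (f t : T -> I) (Z S : {set T}) :
    (forall y, y \in Z -> f y = t y) ->
    (forall i, #|Z :|: S| <= #|[set y | f y == i]|) ->
  exists (W : {set T}) (f' : T -> I),
    [/\ #|W| <= #|S|, forall y, y \in Z :|: S -> f' y = t y,
        forall y, y \notin S -> y \notin W -> f' y = f y
      & forall j, #|[set y | f' y == j]| = #|[set y | f y == j]|].
Proof.
move: {2}(#|S|) (erefl #|S|) => k; elim: k S => [|k IH] S.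
  move/eqP; rewrite cards_eq0 => /eqP -> ft _.
  by exists set0, f; split=> // y; rewrite setU0 => /ft.
move=> cS ft le.
have /card_gt0P [x xS] : 0 < #|S| by lia.
have cS' : #|S :\ x| = k by have := cardsD1 x S; rewrite xS; lia.
have sub : Z :|: S :\ x \subset Z :|: S by rewrite setUS // subsetDl.
have [|W [f1 [cW f1t f1f f1c]]] := IH _ cS' ft.
  by move=> i; apply: leq_trans (le i); apply: subset_leq_card.
case: (boolP (x \in Z)) => xZ.
  exists W, f1; split=> //; first by lia.
    move=> y yZS; apply: f1t; move: yZS; rewrite !inE.
    by have [->|_] := eqVneq y x; rewrite ?xZ.
  by move=> y yS; apply: f1f; rewrite !inE (negbTE yS) andbF.
have xN : x \notin Z :|: S :\ x by rewrite !inE (negbTE xZ) eqxx.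
have [|x' [f2 [f2x f2Z f2f f2c]]] := @recolor1 _ _ f1 _ x (t x) xN.
  rewrite f1c; apply: leq_trans (le _); apply: proper_card.
  by apply/properP; split=> //; exists x; rewrite // inE xS orbT.
exists (x' |: W), f2; split.
- by rewrite cS cardsU1; case: (_ \notin _); lia.
- move=> y yZS; have [->//|yx] := eqVneq y x.
  have yZS' : y \in Z :|: S :\ x by move: yZS; rewrite !inE yx.
  by rewrite f2Z // f1t.
- move=> y yS; rewrite !inE negb_or => /andP [yx' yW].
  have yx : y != x by apply: contraNneq yS => ->.
  by rewrite f2f // f1f // !inE (negbTE yS) andbF.
- by move=> j; rewrite f2c.
Qed.

(** The disjoint union of the ['I_(m i)] has as many elements as [T]; [f] is the tag under a
    bijection. *)
Lemma exists_fibre_card (T : finType) q (m : 'I_q -> nat) :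
  \sum_(i < q) m i = #|T| ->
  exists f : T -> 'I_q, forall i, #|[set x | f x == i]| = m i.
Proof.
move=> sm; pose V : finType := {i : 'I_q & 'I_(m i)}.
have cV : #|V| = #|T|.
  rewrite card_tagged sumnE big_map big_enum /= -sm.
  by apply: eq_bigr => i _; rewrite card_ord.
pose h x : V := enum_val (cast_ord (esym cV) (enum_rank x)).
have hinj : injective h by move=> x y /enum_val_inj /cast_ord_inj /enum_rank_inj.
exists (fun x => tag (h x)) => i.
rewrite -(card_imset _ hinj) -[RHS]card_ord.
have tinj : injective (fun j : 'I_(m i) => Tagged (fun i => 'I_(m i)) j).
  by move=> j k; apply: eq_from_Tagged.
rewrite -(card_imset predT tinj).
apply: eq_card => v; apply/imsetP/imsetP => [[x]|[j _ ->]].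
  by rewrite inE => /eqP <- ->; exists (tagged (h x)) => //; case: (h x).
have /codomP [x hx] : (Tagged (fun i => 'I_(m i)) j : V) \in codom h.
  by apply: inj_card_onto => //; rewrite cV.
by exists x; rewrite ?inE -?hx.
Qed.

(** * Absorbing Hall violators, with the given matching normalized to the identity *)

Section Absorption.
Variables (V I : finType) (E : rel V) (c : V -> V -> I) (f0 : V -> I) (L : nat).
Hypothesis E_refl : forall x, E x x.
Hypothesis expand : forall (f : V -> I) (X Y : {set V}), L <= #|X| -> L <= #|Y| ->
  exists x y, [/\ x \in X, y \in Y, E x y & c x y = f x].
Hypothesis L_small : 10 * L <= #|V|.
Hypothesis f0_large : forall i, 3 * L <= #|[set x | f0 x == i]|.

(* [Z] is the set of vertices kept on the identity matching; its elements came
   from Hall violators [S] on the left or [U] on the right. [D] collects [Z], the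
   recolored vertices and the neighbours of the violators. *)
Definition absorbing (Z S U D : {set V}) (f : V -> I) : Prop :=
  [/\ [/\ Z \subset D, #|D| <= 3 * #|Z| & Z \subset S :|: U],
      forall i, #|[set x | f x == i]| = #|[set x | f0 x == i]|,
      {in Z, forall x, f x = c x x} /\ (forall x, x \notin D -> f x = f0 x),
      forall x, x \in S -> exists i, forall y, y \notin D -> ~~ (E x y && (c x y == i))
    & forall x y, y \in U -> x \notin D -> ~~ (E x y && (c x y == f0 x))].

Definition prescribed_matching : Prop :=
  exists h : V -> V, [/\ injective h, forall x, E x (h x)
    & forall i, #|[set x | c x (h x) == i]| = #|[set x | f0 x == i]|].

(** If [2 * L <= #|Z|], then [S] or [U] has at least [L] elements, and so does the complement of
    [D], since [#|D| <= 9 * L]. Expansion between the two yields an edge that the state forbids. *)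
Lemma absorbing_small Z S U D f :
  absorbing Z S U D f -> #|Z| <= 3 * L -> #|Z| < 2 * L.
Proof.
move=> [[ZD cD /subset_leq_card cZ] _ _ SD UD] leZ; rewrite ltnNge; apply/negP => geZ.
have cDC : L <= #|~: D| by have := cardsC D; lia.
case: (leqP L #|S|) => leS.
  (* Each [x] in [S] has its own forbidden color, which [phi] selects; the default [f0 x] never
     occurs on [S]. *)
  pose phi x := if [pick i | [forall y, (y \notin D) ==> ~~ (E x y && (c x y == i))]]
    is Some i then i else f0 x.
  have [x [y [xS yD Exy cxy]]] := expand phi leS cDC.
  move: cxy; rewrite /phi; case: pickP => [i /forallP /(_ y)|no].
    by rewrite -in_setC yD Exy /= => /negP h e; apply: h; rewrite e.
  have [i iP] := SD x xS; move: (no i) => /negP [].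
  by apply/forallP => z; apply/implyP; apply: iP.
have leU : L <= #|U| by have := (leq_card_setU S U).1; lia.
have [x [y [xD yU Exy cxy]]] := expand f0 cDC leU.
by have := UD x y yU; rewrite -in_setC xD Exy cxy eqxx => /(_ isT).
Qed.

(** If Hall's condition holds off [Z], the matching found there is completed by the identity on [Z].
    Otherwise a violator [X], or if [X] is large the right vertices it misses, joins [Z]. *)
Lemma absorbing_step Z S U D f : absorbing Z S U D f -> #|Z| < 2 * L ->
  prescribed_matching \/
  exists Z' S' U' D' f', absorbing Z' S' U' D' f' /\ #|Z| < #|Z'| <= #|Z| + L.
Proof.
move=> [[ZD cD cZ] fc [fZ fD] SD UD] ltZ.
pose r x y := [&& E x y, c x y == f x & y \notin Z].
case: (boolP [forall S : {set V}, (S \subset ~: Z) ==> (#|S| <= #|nbr r S|)]).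
  move/forallP => hall; left.
  have [|h [hinj hr]] := @Hall V V id r (~: Z).
    by move=> X sX; have := hall X; rewrite sX.
  have hr' x : x \notin Z -> [/\ E x (h x), c x (h x) = f x & h x \notin Z].
    by rewrite -in_setC => /hr /and3P [-> /eqP -> ->].
  exists (fun x => if x \in Z then x else h x); split.
  - move=> x y; case: ifP => xZ; case: ifP => yZ //.
    + by have [_ _ hy] := hr' y (negbT yZ) => e; case/negP: hy; rewrite -e.
    + by have [_ _ hx] := hr' x (negbT xZ) => e; case/negP: hx; rewrite e.
    + by apply: hinj; rewrite !inE ?xZ ?yZ.
  - by move=> x; case: ifPn => xZ //; have [] := hr' x xZ.
  - move=> i; rewrite -fc; apply: eq_card => x; rewrite !inE.
    by case: ifPn => xZ; [rewrite fZ | have [_ -> _] := hr' x xZ].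
rewrite negb_forall => /existsP [X]; rewrite negb_imply -ltnNge => /andP [sX vX].
right.
(* Shared by both cases: [Y] is the violator and [T] contains its neighbours off [Z]. As
   [#|T| < #|Y|] and at most [#|Y|] swap partners appear, [D] grows by at most [3 * #|Y|];
   recoloring is possible since [#|Z :|: Y| <= 3 * L]. *)
have grow (Y T : {set V}) : Y \subset ~: Z -> #|T| < #|Y| -> #|Y| <= L ->
  exists (D' : {set V}) f', [/\ D :|: Y :|: T \subset D',
    #|D'| <= 3 * #|Z :|: Y| /\ #|Z :|: Y| = #|Z| + #|Y|,
    (forall i, #|[set x | f' x == i]| = #|[set x | f0 x == i]|),
    {in Z :|: Y, forall x, f' x = c x x} & (forall x, x \notin D' -> f' x = f0 x)].
  move=> sY ltT leY.
  have cU : #|Z :|: Y| = #|Z| + #|Y|.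
    rewrite cardsU; suff -> : Z :&: Y = set0 by rewrite cards0 subn0.
    apply/eqP; rewrite -subset0; apply/subsetP => x; rewrite inE => /andP [xZ].
    by move/(subsetP sY); rewrite inE xZ.
  have [|W [f' [cW f't f'f f'c]]] := @recolor V I f (fun x => c x x) Z Y fZ.
    by move=> i; rewrite fc; apply: leq_trans (f0_large i); rewrite cU; lia.
  exists (D :|: Y :|: T :|: W), f'; split=> //.
  - exact: subsetUl.
  - split=> //; have := (leq_card_setU (D :|: Y :|: T) W).1.
    have := (leq_card_setU (D :|: Y) T).1.
    have := (leq_card_setU D Y).1; rewrite cU; lia.
  - by move=> i; rewrite f'c fc.
  - move=> x; rewrite !inE !negb_or => /andP [/andP [/andP [xD xY] _] xW].
    by rewrite f'f // fD.
have rX x y : x \in X -> y \notin nbr r X -> y \notin Z -> ~~ (E x y && (c x y == f x)).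
  move=> xX yN yZ; apply: contra yN => /andP [Exy cxy].
  by apply/nbrP; exists x; rewrite // /r Exy cxy.
have sN : nbr r X \subset ~: Z.
  by apply/subsetP => y /nbrP [x _ /and3P [_ _ yZ]]; rewrite inE.
case: (ltnP #|X| L) => leX.
  have [|D' [f' [sD' [cD' cU] f'c f'Z f'D]]] := grow X (nbr r X) sX vX; first lia.
  have DD' : D \subset D' by apply: subset_trans sD'; rewrite -setUA subsetUl.
  have ZD' : Z :|: X \subset D'.
    by apply: subset_trans sD'; rewrite (subset_trans _ (subsetUl _ _)) // setSU.
  exists (Z :|: X), (S :|: X), U, D', f'; split; last by lia.
  split=> //.
  - by split=> //; rewrite setUAC setSU.
  - move=> x; rewrite inE => /orP [/SD [i iP]|xX].
      by exists i => y yD'; apply: iP; apply: contra yD'; apply: (subsetP DD').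
    (* The witness is the color wanted at [x] when the violator was found, before [x] is recolored
       to [c x x]. *)
    exists (f x) => y yD'; apply: rX => //.
      by apply: contra yD' => yN; apply: (subsetP sD'); rewrite in_setU yN orbT.
    by apply: contra yD' => yZ; apply: (subsetP ZD'); rewrite in_setU yZ.
  - move=> x y yU xD'; apply: UD => //; apply: contra xD'; exact: (subsetP DD').
(* [Y] consists of right vertices and [T] of left ones: every admissible edge into [Y] starts in
   [T], so [Y] violates Hall's condition from the other side, and expansion from [X] makes it
   small. *)
pose Y := ~: Z :\: nbr r X; pose T := ~: Z :\: X.
have ltY : #|Y| < L.
  rewrite ltnNge; apply/negP => leY.
  have [x [y [xX yY Exy cxy]]] := expand f leX leY.
  move: yY; rewrite in_setD in_setC => /andP [yN yZ].
  by have := rX x y xX yN yZ; rewrite Exy cxy eqxx.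
have ltT : #|T| < #|Y|.
  have := cardsID X (~: Z); have := cardsID (nbr r X) (~: Z).
  by rewrite (setIidPr sX) (setIidPr sN) -/Y -/T; lia.
have sY : Y \subset ~: Z by apply: subsetDl.
have [|D' [f' [sD' [cD' cU] f'c f'Z f'D]]] := grow Y T sY ltT; first lia.
have DD' : D \subset D' by apply: subset_trans sD'; rewrite -setUA subsetUl.
have ZD' : Z :|: Y \subset D'.
  by apply: subset_trans sD'; rewrite (subset_trans _ (subsetUl _ _)) // setSU.
exists (Z :|: Y), S, (U :|: Y), D', f'; split; last by lia.
split=> //.
- by split=> //; rewrite setUA setSU.
- move=> x /SD [i iP]; exists i => y yD'; apply: iP.
  by apply: contra yD'; apply: (subsetP DD').
- move=> x y; rewrite in_setU => /orP [yU xD'|yY xD'].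
    by apply: UD => //; apply: contra xD'; apply: (subsetP DD').
  have xD : x \notin D by apply: contra xD'; apply: (subsetP DD').
  (* Off [D] the current [f] is still [f0], so the obstruction can be recorded with [f0] and
     survives later recolorings. *)
  rewrite -fD //; move: yY; rewrite in_setD in_setC => /andP [yN yZ].
  apply: rX => //; apply: contraR xD' => xX; apply: (subsetP sD').
  rewrite in_setU /T !inE xX /=; case: (boolP (x \in Z)) => [/(subsetP ZD) ->|] //.
  by rewrite orbT.
Qed.

(** Every step enlarges [Z] by between 1 and [L] vertices, so its size stays within [3 * L] and
    hence, by [absorbing_small], below [2 * L]; after [2 * L] steps only the matching is left. *)
Lemma absorption : prescribed_matching.
Proof.
suff : forall k, prescribed_matching \/
    exists Z S U D f, absorbing Z S U D f /\ k <= #|Z| < 2 * L.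
  move/(_ (2 * L)) => [//|[Z [S [U [D [f [_ /andP [le lt]]]]]]]].
  by move: (leq_ltn_trans le lt); rewrite ltnn.
elim=> [|k [|[Z [S [U [D [f [st /andP [le lt]]]]]]]]]; last first.
- have [|[Z' [S' [U' [D' [f' [st' /andP [lt' le']]]]]]]] := absorbing_step st lt.
    by left.
  right; exists Z', S', U', D', f'; split=> //.
  by rewrite (leq_ltn_trans le lt') (absorbing_small st') //; lia.
- by left.
- right; exists set0, set0, set0, set0, f0.
  have st : absorbing set0 set0 set0 set0 f0.
    split=> //; first by rewrite !sub0set cards0.
    all: try by move=> x; rewrite inE.
    by split=> // x; rewrite inE.
    by move=> x y; rewrite inE.
  by split=> //; rewrite (absorbing_small st) // cards0.
Qed.

End Absorption.

(** * From expansion in each color to matchings with prescribed color counts *)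

Lemma large_fibre (T : finType) q (f : T -> 'I_q) (X : {set T}) K :
  0 < q -> q * K <= #|X| -> exists i, K <= #|[set x in X | f x == i]|.
Proof.
move=> q0 leX; apply/existsP; apply: contraLR leX.
rewrite negb_exists -ltnNge => /forallP small.
have -> : #|X| = \sum_(i < q) #|[set x in X | f x == i]|.
  rewrite -sum1_card (partition_big f predT) //=.
  by apply: eq_bigr => i _; rewrite -sum1_card; apply: eq_bigl => x; rewrite inE.
have -> : q * K = \sum_(i < q) K by rewrite sum_nat_const card_ord.
rewrite (bigD1 (Ordinal q0)) //= [ltnRHS](bigD1 (Ordinal q0)) //=.
rewrite -addSn leq_add //; first by rewrite ltnNge.
by apply: leq_sum => i _; rewrite ltnW // ltnNge.
Qed.

(** Relabelling the right class along [g] turns [g] into the identity. Absorption is used with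
    [L = q * K]: among [q * K] vertices some [K] want the same color, and expansion in that color
    applies. *)
Lemma matching_prescribed_colors (V : finType) q (E : rel V) (c : V -> V -> 'I_q)
    (g : V -> V) K (m : 'I_q -> nat) :
    injective g -> (forall x, E x (g x)) ->
    (forall (X Y : {set V}) i, K <= #|X| -> K <= #|Y| ->
       exists x y, [/\ x \in X, y \in Y, E x y & c x y = i]) ->
    0 < q -> 10 * (q * K) <= #|V| ->
    \sum_(i < q) m i = #|V| -> (forall i, 3 * (q * K) <= m i) ->
  exists h : V -> V, [/\ injective h, forall x, E x (h x)
    & forall i, #|[set x | c x (h x) == i]| = m i].
Proof.
move=> ginj Eg expand q0 leV sm lem.
have [f0 f0m] := exists_fibre_card sm.
have [||h [hinj Eh hc]] := @absorption V _ (fun x y => E x (g y))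
    (fun x y => c x (g y)) f0 (q * K) Eg _ leV.
- move=> f X Y leX leY; have [i leXi] := large_fibre f q0 leX.
  have [|x [_ [xX /imsetP [y yY ->] Exy cxy]]] := expand _ (g @: Y) i leXi.
    by rewrite card_imset //; apply: leq_trans leY; rewrite leq_pmull.
  by move: xX; rewrite inE => /andP [xX /eqP fx]; exists x, y; rewrite fx.
- by move=> i; rewrite f0m.
by exists (g \o h); split=> // [|i]; [apply: inj_comp | rewrite hc].
Qed.

(* In a minimal Hall violator [S] every vertex of [nbr r S] keeps a neighbour
   when any vertex of [S] is deleted. *)
Lemma minimal_violator (V : finType) (r : rel V) (X : {set V}) :
    #|nbr r X| < #|X| ->
  exists (S T : {set V}) (g : {ffun V -> V * V}),
    [/\ #|S| = #|T|.+1, #|S| <= #|X|, {in S & ~: T, forall x y, ~~ r x y},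
        forall t, t \notin T -> g t = (t, t)
      & forall t, t \in T -> [/\ (g t).1 \in S, (g t).2 \in S,
          (g t).1 != (g t).2, r (g t).1 t & r (g t).2 t]].
Proof.
move=> vX; pose viol S := #|nbr r S| < #|S|.
case: (@arg_minnP _ X viol (fun S : {set V} => #|S|) vX) => S; rewrite /viol => vS minS.
have le x : x \in S -> #|S| <= #|nbr r (S :\ x)|.+1.
  move=> xS; have := minS (S :\ x); have := cardsD1 x S; rewrite xS.
  by case: (ltnP #|nbr r (S :\ x)| #|S :\ x|) => [_|]; [move=> e /(_ isT)|]; lia.
(* Minimality gives [#|S| - 1 <= #|nbr r (S :\ x)| <= #|nbr r S| < #|S|], so deleting [x] loses no
   neighbour. *)
have nbrD x : x \in S -> nbr r (S :\ x) = nbr r S.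
  move=> xS; apply/eqP; rewrite eqEcard nbrS ?subsetDl //=.
  by have := le x xS; lia.
pose good t (p : V * V) := [&& p.1 \in S, p.2 \in S, p.1 != p.2, r p.1 t & r p.2 t].
exists S, (nbr r S), [ffun t => if t \in nbr r S
  then odflt (t, t) [pick p | good t p] else (t, t)]; split.
- have /card_gt0P [x xS] : 0 < #|S| by lia.
  by have := le x xS; rewrite nbrD //; lia.
- exact: minS.
- move=> x y xS; rewrite in_setC; apply: contra => rxy.
  by apply/nbrP; exists x.
- by move=> t tN; rewrite ffunE (negbTE tN).
- move=> t tN; rewrite ffunE tN; case: pickP => [p /and5P [] //|no].
  have /nbrP [x xS rx] := tN.
  have : t \in nbr r (S :\ x) by rewrite nbrD.
  case/nbrP => y; rewrite in_setD1 => /andP [yx yS] ry.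
  by have := no (x, y); rewrite /good /= xS yS rx ry eq_sym yx.
Qed.

(** The flag tells in which class the violator lies, so one statement covers both sides. *)
Definition orient (T : Type) (o : bool) (x y : T) : T * T :=
  if o then (x, y) else (y, x).

(** A violator [X] with more than [K] vertices is replaced by the right vertices it misses: by
    expansion there are at most [K] of them, and their neighbours avoid [X], so they violate Hall's
    condition too. A minimal violator is then extracted. *)
Lemma matching_or_violator (V : finType) (E : {set V * V}) K :
    (forall X Y : {set V}, K <= #|X| -> K <= #|Y| ->
       exists x y, [/\ x \in X, y \in Y & (x, y) \in E]) ->
  (exists h : V -> V, injective h /\ forall x, (x, h x) \in E) \/
  exists (o : bool) (S T : {set V}) (g : {ffun V -> V * V}),
    [/\ #|S| = #|T|.+1, #|T| < K, {in S & ~: T, forall x y, orient o x y \notin E},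
        forall t, t \notin T -> g t = (t, t)
      & forall t, t \in T -> [/\ (g t).1 \in S, (g t).2 \in S,
          (g t).1 != (g t).2, orient o (g t).1 t \in E & orient o (g t).2 t \in E]].
Proof.
move=> expand; pose r x y := (x, y) \in E.
case: (boolP [forall S : {set V}, #|S| <= #|nbr r S|]) => [/forallP hall|].
  have [|h [hinj hr]] := @Hall V V id r setT; first by move=> S _.
  left; exists h; split=> [x y|x]; first by apply: hinj; rewrite in_setT.
  by apply: hr; rewrite in_setT.
rewrite negb_forall => /existsP [X]; rewrite -ltnNge => vX; right.
suff [o [Y [vY leY]]] : exists (o : bool) (Y : {set V}),
    #|nbr (fun x y => orient o x y \in E) Y| < #|Y| /\ #|Y| <= K.
  have [S [T [g [cS leS rS gN gT]]]] := minimal_violator vY.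
  by exists o, S, T, g; split=> //; lia.
case: (leqP #|X| K) => leX; first by exists true, X.
exists false, (~: nbr r X).
have cX := cardsC X; have cN := cardsC (nbr r X); split.
  have : nbr (fun x y => orient false x y \in E) (~: nbr r X) \subset ~: X.
    apply/subsetP => x /nbrP [y]; rewrite !in_setC => yN Exy; apply: contra yN => xX.
    by apply/nbrP; exists x.
  by move/subset_leq_card; lia.
rewrite leqNgt; apply/negP => ltN.
have [||x [y [xX yN Exy]]] := expand X (~: nbr r X); try lia.
by move: yN; rewrite in_setC => /nbrP []; exists x.
Qed.

Lemma has_colored_pm_of_injective n q (m : 'I_q -> nat) (E : {set edge n})
    (c : {ffun edge n -> 'I_q}) (h : 'I_n -> 'I_n) :
    injective h -> (forall x, (x, h x) \in E) ->
    (forall i, #|[set x | c (x, h x) == i]| = m i) ->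
  has_colored_pm m E c.
Proof.
move=> hinj hE hc; pose e x : edge n := (x, h x).
have einj : injective e by move=> x y [].
apply/existsP; exists (e @: 'I_n); apply/andP; split; last first.
  apply/forallP => i; rewrite /color_count -hc -(card_imset _ einj).
  apply/eqP/eq_card => d; rewrite inE; apply/andP/imsetP.
    by case=> /imsetP [x _ ->] cx; exists x; rewrite ?inE.
  by case=> x; rewrite inE => cx ->; split; [apply: imset_f|].
apply/andP; split; first by apply/subsetP => d /imsetP [x _ ->]; apply: hE.
(* It suffices to name the left end [x] of the unique matching edge at [v]; for [v] on the right
   this is surjectivity of [h]. *)
apply/forallP => v; suff [x vx] : exists x, forall y, incident v (e y) = (y == x).
  rewrite (_ : [set _ in _ | _] = [set e x]) ?cards1 //.
  apply/setP => d; rewrite !inE; apply/andP/eqP => [[/imsetP [y _ ->]]|->].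
    by rewrite vx => /eqP ->.
  by rewrite vx eqxx imset_f.
case: v => [x|y] /=; first by exists x.
have /codomP [x ->] : y \in codom h by apply: inj_card_onto.
by exists x => z; rewrite (inj_eq hinj).
Qed.

(** * The probability of product events *)

Local Open Scope ring_scope.

Section ColoredGraphProbability.
Variables (R : realType) (n q : nat) (p : R) (alpha : 'I_q -> R).
Hypotheses (p_ge0 : 0 <= p) (p_le1 : p <= 1) (alpha_gt0 : forall i, 0 < alpha i).
Hypothesis alpha_sum : \sum_(i < q) alpha i = 1.

Local Notation prob := (@colored_gnnp_prob R n q p alpha).
Implicit Types (A B : {set edge n} -> {ffun edge n -> 'I_q} -> bool).

Let weight (E : {set edge n}) (c : {ffun edge n -> 'I_q}) :=
  gnnp_weight p E * coloring_weight alpha c.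

Let weight_ge0 E c : 0 <= weight E c.
Proof.
rewrite mulr_ge0 // prodr_ge0 // => e _; last exact: ltW.
by case: ifP => _ //; rewrite subr_ge0.
Qed.

Lemma prob_union (I : finType) (P : pred I) A
    (B : I -> {set edge n} -> {ffun edge n -> 'I_q} -> bool) :
  (forall E c, A E c -> exists2 i, P i & B i E c) ->
  prob A <= \sum_(i | P i) prob (B i).
Proof.
move=> AB; rewrite /colored_gnnp_prob exchange_big /=; apply: ler_sum => E _.
under [leRHS]eq_bigr do rewrite big_mkcond.
rewrite exchange_big /= big_mkcond /=; apply: ler_sum => c _.
have ge0 i : 0 <= if B i E c then weight E c else 0 by case: ifP.
case: ifP => [/AB [i Pi Bi]|_]; last by apply: sumr_ge0 => i _; apply: ge0.
rewrite (bigD1 i) //= Bi lerDl; apply: sumr_ge0 => j _; apply: ge0.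
Qed.

Lemma prob_or A B C : (forall E c, A E c -> B E c || C E c) ->
  prob A <= prob B + prob C.
Proof.
move=> AB; have := @prob_union bool predT A (fun b => if b then B else C).
rewrite big_bool /=; apply => E c /AB /orP [h|h]; [by exists true|by exists false].
Qed.

Lemma probC A : prob A = 1 - prob (fun E c => ~~ A E c).
Proof.
apply/eqP; rewrite eq_sym subr_eq -(colored_gnnp_probT n p alpha_sum) -big_split /=.
apply/eqP/eq_bigr => E _; rewrite [in RHS]big_mkcond [X in _ = _ + X]big_mkcond /=.
by rewrite -big_split; apply: eq_bigr => c _; case: (A E c); rewrite /= ?addr0 ?add0r.
Qed.

Lemma prob_ge0 A : 0 <= prob A.
Proof. by apply: sumr_ge0 => E _; apply: sumr_ge0 => c _; apply: weight_ge0. Qed.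

Lemma prob_le1 A : prob A <= 1.
Proof. by rewrite probC gerBl prob_ge0. Qed.

(** Presence and color are independent over all edges, so a condition imposed edge by edge
    factorizes. Expanding the product first over edge sets, then over colorings, gives the double
    sum. *)
Lemma prob_forall (phi : edge n -> bool -> 'I_q -> bool) :
  prob (fun E c => [forall e, phi e (e \in E) (c e)]) =
  \prod_e (p * (\sum_(i | phi e true i) alpha i)
           + (1 - p) * (\sum_(i | phi e false i) alpha i)).
Proof.
rewrite bigA_distr; apply: eq_bigr => E _.
pose F e i := if phi e (e \in E) i then (if e \in E then p else 1 - p) * alpha i else 0.
transitivity (\sum_(c : {ffun edge n -> 'I_q}) \prod_e F e (c e)).
  rewrite big_mkcond; apply: eq_bigr => c _; case: ifPn => [/forallP h|].
    by rewrite -big_split; apply: eq_bigr => e _; rewrite /F h.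
  rewrite negb_forall => /existsP [e he].
  by rewrite (bigD1 e) //= /F (negbTE he) mul0r.
rewrite -bigA_distr_bigA; apply: eq_bigr => e _.
by rewrite /F; case: ifP => _; rewrite -big_mkcond big_distrr.
Qed.

Lemma prod_if_mem (D : {set edge n}) (x : R) :
  \prod_e (if e \in D then x else 1) = x ^+ #|D|.
Proof. by rewrite -big_mkcond prodr_const. Qed.

Lemma prob_no_color (D : {set edge n}) i :
  prob (fun E c => [forall e in D, ~~ ((e \in E) && (c e == i))]) =
  (1 - p * alpha i) ^+ #|D|.
Proof.
rewrite (prob_forall (fun e b j => (e \in D) ==> ~~ (b && (j == i)))).
rewrite -prod_if_mem; apply: eq_bigr => e _; case: (e \in D) => /=.
  have -> : \sum_(j < q | j != i) alpha j = 1 - alpha i.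
    by rewrite -alpha_sum [in RHS](bigD1 i) //= addrAC subrr add0r.
  by rewrite alpha_sum; ring.
by rewrite alpha_sum; ring.
Qed.

Lemma prob_in_out (D1 D0 : {set edge n}) : [disjoint D1 & D0] ->
  prob (fun E c => [forall e,
    ((e \in D1) ==> (e \in E)) && ((e \in D0) ==> (e \notin E))])
  = p ^+ #|D1| * (1 - p) ^+ #|D0|.
Proof.
move=> dis.
rewrite (prob_forall (fun e b j => ((e \in D1) ==> b) && ((e \in D0) ==> ~~ b))).
rewrite -!prod_if_mem -big_split; apply: eq_bigr => e _ /=.
have := disjointFr dis (x := e); case: (e \in D1) => /= h.
  by rewrite h //= big_pred0_eq alpha_sum; ring.
by case: (e \in D0); rewrite /= ?big_pred0_eq alpha_sum; ring.
Qed.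

End ColoredGraphProbability.

(** * Union bounds *)

Definition color_hole n q (K : nat) (E : {set edge n}) (c : {ffun edge n -> 'I_q}) :=
  [exists X : {set 'I_n}, exists Y : {set 'I_n}, exists i : 'I_q,
    [&& (K <= #|X|)%N, (K <= #|Y|)%N
      & [forall e in setX X Y, ~~ ((e \in E) && (c e == i))]]].

(** The edges whose presence is certified by [g]: two for each vertex of [T]. *)
Definition twofold n (o : bool) (T : {set 'I_n}) (g : {ffun 'I_n -> 'I_n * 'I_n}) :
    {set edge n} :=
  [set orient o (g t).1 t | t in T] :|: [set orient o (g t).2 t | t in T].

Definition outside n (o : bool) (S T : {set 'I_n}) : {set edge n} :=
  [set orient o e.1 e.2 | e in setX S (~: T)].

Definition in_out n (D1 D0 E : {set edge n}) :=
  [forall e, ((e \in D1) ==> (e \in E)) && ((e \in D0) ==> (e \notin E))].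

(* Outside [T] the value of [g] is irrelevant, so it is frozen to make the
   number of such [g] equal to (number of ordered pairs in [S])^|T|. *)
Definition pair_choice n (S T : {set 'I_n}) (t : 'I_n) : pred ('I_n * 'I_n) :=
  if t \in T then [pred a | [&& a.1 \in S, a.2 \in S & a.1 != a.2]] else pred1 (t, t).

(** The output of [matching_or_violator], with sizes fixed first so that the union bound can be
    taken one quantifier at a time. *)
Definition small_violator n (K : nat) (E : {set edge n}) :=
  [exists j : 'I_K, exists o : bool,
   exists S : {set 'I_n} in [set S : {set 'I_n} | #|S| == j.+1],
   exists T : {set 'I_n} in [set T : {set 'I_n} | #|T| == j],
   exists g : {ffun 'I_n -> 'I_n * 'I_n} in family (pair_choice S T),
   in_out (twofold o T g) (outside o S T) E].

Lemma orient_inj (T : Type) o (x y x' y' : T) :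
  orient o x y = orient o x' y' -> x = x' /\ y = y'.
Proof. by case: o => -[-> ->]. Qed.

(** The deterministic half of the proof: no hole means expansion in every color; with no small
    violator this gives a perfect matching, which is then corrected to the prescribed color
    counts. *)
Lemma has_colored_pm_or n q (m : 'I_q -> nat) K (E : {set edge n})
    (c : {ffun edge n -> 'I_q}) :
    (0 < q)%N -> (10 * (q * K) <= n)%N -> (\sum_(i < q) m i)%N = n ->
    (forall i, 3 * (q * K) <= m i)%N ->
  ~~ has_colored_pm m E c -> color_hole K E c || small_violator K E.
Proof.
move=> q0 len sm lem; apply: contraR; rewrite negb_or => /andP [nohole noviol].
have expand (X Y : {set 'I_n}) i : (K <= #|X|)%N -> (K <= #|Y|)%N ->
    exists x y, [/\ x \in X, y \in Y, (x, y) \in E & c (x, y) = i].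
  move=> leX leY; move: nohole.
  rewrite negb_exists => /forallP /(_ X); rewrite negb_exists => /forallP /(_ Y).
  rewrite negb_exists => /forallP /(_ i); rewrite leX leY /=.
  rewrite negb_forall => /existsP [[x y]]; rewrite negb_imply negbK in_setX /=.
  by case/andP => /andP [xX yY] /andP [xyE /eqP cxy]; exists x, y.
have [|[g [ginj gE]]|] := @matching_or_violator _ E K.
(* Any color will do here, since only the edge itself is wanted. *)
- move=> X Y leX leY; have [x [y [xX yY xyE _]]] := expand X Y (Ordinal q0) leX leY.
  by exists x, y.
- have [|||h [hinj hE hc]] := @matching_prescribed_colors _ q
      (fun x y => (x, y) \in E) (fun x y => c (x, y)) g K m ginj gE expand q0.
  + by rewrite card_ord.
  + by rewrite card_ord.
  + exact: lem.
  exact: has_colored_pm_of_injective hinj hE hc.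
- case=> o [S [T [g [cS ltT ST gN gT]]]]; case/negP: noviol.
  apply/existsP; exists (Ordinal ltT); apply/existsP; exists o.
  apply/exists_inP; exists S; first by rewrite inE cS.
  apply/exists_inP; exists T; first by rewrite inE.
  apply/exists_inP; exists g.
    apply/familyP => t; rewrite /pair_choice; case: ifPn => [/gT [h1 h2 h3 _ _]|/gN ->].
      by rewrite inE h1 h2 h3.
    by rewrite inE.
  apply/forallP => e; apply/andP; split; apply/implyP.
    by rewrite inE => /orP [] /imsetP [t /gT [_ _ _ h1 h2] ->].
  by case/imsetP => -[x y]; rewrite in_setX => /andP [xS yT] ->; apply: ST.
Qed.

(** Frozen values contribute a factor 1; on [T] the distinctness of the two components is
    dropped. *)
Lemma card_pair_choice n (S T : {set 'I_n}) :
  (#|family (pair_choice S T)| <= (#|S| ^ 2) ^ #|T|)%N.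
Proof.
rewrite card_family foldrE big_map big_enum /=.
rewrite -[leqRHS]prod_nat_const [leqRHS]big_mkcond /=; apply: leq_prod => t _.
rewrite /pair_choice; case: ifP => _; last by rewrite card1.
have -> : (#|S| ^ 2 = #|setX S S|)%N by rewrite cardsX mulnn.
by apply: subset_leq_card; apply/subsetP => a; rewrite !inE => /and3P [-> ->].
Qed.

Lemma card_twofold n o (S T : {set 'I_n}) g :
  g \in family (pair_choice S T) -> #|twofold o T g| = (2 * #|T|)%N.
Proof.
move=> /familyP gF; rewrite cardsU.
have -> : [set orient o (g t).1 t | t in T] :&: [set orient o (g t).2 t | t in T] = set0.
  apply/eqP; rewrite -subset0; apply/subsetP => e; rewrite inE.
  case/andP => /imsetP [t tT ->] /imsetP [u uT eq].
  have [e12 tu] := orient_inj eq.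
  by move: e12 (gF t); rewrite -tu /pair_choice tT inE => -> /and3P [_ _]; rewrite eqxx.
rewrite !card_imset ?cards0; first by rewrite subn0 mul2n addnn.
all: by move=> t u eq; have [] := orient_inj eq.
Qed.

Lemma card_outside n o (S T : {set 'I_n}) :
  #|outside o S T| = (#|S| * (n - #|T|))%N.
Proof.
rewrite card_imset; last by move=> [x y] [x' y'] eq; have [/= -> ->] := orient_inj eq.
by rewrite cardsX [#|~: T|]cardsCs setCK card_ord.
Qed.

Lemma disjoint_twofold_outside n o (S T : {set 'I_n}) g :
  [disjoint twofold o T g & outside o S T].
Proof.
rewrite -setI_eq0 -subset0; apply/subsetP => e; rewrite inE => /andP [eD].
case/imsetP => -[x y]; rewrite in_setX in_setC /= => /andP [_ yT] eE.
by move: eD; rewrite inE eE => /orP [] /imsetP [t tT eq];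
  have [_ yt] := orient_inj eq; rewrite yt tT in yT.
Qed.

Section UnionBounds.
Variables (R : realType) (n q : nat) (p : R) (alpha : 'I_q -> R).
Hypotheses (p_ge0 : 0 <= p) (p_le1 : p <= 1) (alpha_gt0 : forall i, 0 < alpha i).
Hypothesis alpha_sum : \sum_(i < q) alpha i = 1.

Local Notation prob := (@colored_gnnp_prob R n q p alpha).

Let union := @prob_union R n q p alpha p_ge0 p_le1 alpha_gt0.

Lemma alpha_le1 i : alpha i <= 1.
Proof.
by rewrite -alpha_sum (bigD1 i) //= lerDl sumr_ge0 // => j _; apply: ltW.
Qed.

(** There are at most [2 ^ n] choices for each of [X] and [Y], and sets larger than [K] only make
    the event rarer. *)
Lemma prob_color_hole K :
  prob (color_hole K) <= \sum_(i < q) 4 ^+ n * (1 - p * alpha i) ^+ (K * K).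
Proof.
have card_sets : #|{: {set 'I_n}}| = (2 ^ n)%N.
  by rewrite -cardsT -powersetT card_powerset cardsT card_ord.
have hX := @union _ (fun X : {set 'I_n} => (K <= #|X|)%N) (color_hole K)
  (fun X E c => [exists Y : {set 'I_n}, exists i : 'I_q,
    (K <= #|Y|)%N && [forall e in setX X Y, ~~ ((e \in E) && (c e == i))]]).
apply: (le_trans (hX _)) => [E c|].
  case/existsP => X /existsP [Y /existsP [i /and3P [leX leY h]]].
  by exists X => //; apply/existsP; exists Y; apply/existsP; exists i; rewrite leY.
pose bnd := \sum_(i < q) (1 - p * alpha i) ^+ (K * K).
have ge0 i : 0 <= 1 - p * alpha i.
  by rewrite subr_ge0 mulr_ile1 // ?alpha_le1 // ltW.
have bnd_ge0 : 0 <= bnd by apply: sumr_ge0 => i _; rewrite exprn_ge0.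
rewrite -big_distrr /= -/bnd.
have bX (X : {set 'I_n}) : (K <= #|X|)%N ->
  prob (fun E c => [exists Y : {set 'I_n}, exists i : 'I_q,
    (K <= #|Y|)%N && [forall e in setX X Y, ~~ ((e \in E) && (c e == i))]])
    <= 2 ^+ n * bnd.
  move=> leX.
  have hY := @union _ (fun Y : {set 'I_n} => (K <= #|Y|)%N) _
    (fun Y E c => [exists i : 'I_q,
      [forall e in setX X Y, ~~ ((e \in E) && (c e == i))]]).
  apply: (le_trans (hY _ _)) => [E c|].
    case/existsP => Y /existsP [i /andP [leY h]].
    by exists Y => //; apply/existsP; exists i.
  apply: (@le_trans _ _ (\sum_(Y : {set 'I_n}) bnd)); last first.
    by rewrite sumr_const card_sets -natrX mulr_natl.
  rewrite big_mkcond; apply: ler_sum => Y _; case: ifP => // leY.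
  have hi := @union _ predT _ (fun i E c =>
    [forall e in setX X Y, ~~ ((e \in E) && (c e == i))]).
  apply: (le_trans (hi _ _)) => [E c|]; first by case/existsP => i h; exists i.
  apply: ler_sum => i _; rewrite prob_no_color // cardsX.
  by apply: ler_wiXn2l => //; [rewrite gerBl mulr_ge0 // ltW | rewrite leq_mul].
apply: (@le_trans _ _ (\sum_(X : {set 'I_n}) 2 ^+ n * bnd)); last first.
  rewrite sumr_const card_sets -[_ *+ (2 ^ n)]mulr_natl natrX mulrA -exprMn.
  by rewrite -natrM.
rewrite big_mkcond; apply: ler_sum => X _; case: ifP => [/bX //|_].
by rewrite mulr_ge0 // exprn_ge0.
Qed.

(** The factors count [o], [S], [T] and [g] in this order; the last one is the probability of the
    prescribed present and absent edges. *)
Lemma prob_small_violator K :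
  prob (fun E _ => small_violator K E) <=
  \sum_(j < K) 2 * 'C(n, j.+1)%:R * 'C(n, j)%:R * (j.+1%:R ^+ 2) ^+ j
     * (p ^+ (2 * j) * (1 - p) ^+ (j.+1 * (n - j))).
Proof.
apply: (le_trans (@union _ predT _ (fun (j : 'I_K) E _ => [exists o : bool,
   exists S : {set 'I_n} in [set S : {set 'I_n} | #|S| == j.+1],
   exists T : {set 'I_n} in [set T : {set 'I_n} | #|T| == j],
   exists g : {ffun 'I_n -> 'I_n * 'I_n} in family (pair_choice S T),
   in_out (twofold o T g) (outside o S T) E]) _)) => [E c /existsP [j h]|].
  by exists j.
apply: ler_sum => j _; set w := p ^+ _ * _.
have w_ge0 : 0 <= w by rewrite mulr_ge0 ?exprn_ge0 // subr_ge0.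
apply: (le_trans (@union _ predT _ (fun (o : bool) E _ => [exists
   S : {set 'I_n} in [set S : {set 'I_n} | #|S| == j.+1],
   exists T : {set 'I_n} in [set T : {set 'I_n} | #|T| == j],
   exists g : {ffun 'I_n -> 'I_n * 'I_n} in family (pair_choice S T),
   in_out (twofold o T g) (outside o S T) E]) _)) => [E c /existsP [o h]|].
  by exists o.
apply: (@le_trans _ _ (\sum_(o : bool)
    'C(n, j.+1)%:R * 'C(n, j)%:R * (j.+1%:R ^+ 2) ^+ j * w)); last first.
  by rewrite sumr_const card_bool -[_ *+ 2]mulr_natl !mulrA.
apply: ler_sum => o _.
apply: (le_trans (@union _ [in [set S : {set 'I_n} | #|S| == j.+1]] _ (fun S E _ =>
   [exists T : {set 'I_n} in [set T : {set 'I_n} | #|T| == j],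
   exists g : {ffun 'I_n -> 'I_n * 'I_n} in family (pair_choice S T),
   in_out (twofold o T g) (outside o S T) E]) _)) => [E c /exists_inP [S hS h]|].
  by exists S.
rewrite -!mulrA -[X in 'C(X, j.+1)]card_ord -card_draws mulr_natl -sumr_const.
apply: ler_sum => S; rewrite inE => /eqP cS.
apply: (le_trans (@union _ [in [set T : {set 'I_n} | #|T| == j]] _ (fun T E _ =>
   [exists g : {ffun 'I_n -> 'I_n * 'I_n} in family (pair_choice S T),
   in_out (twofold o T g) (outside o S T) E]) _)) => [E c /exists_inP [T hT h]|].
  by exists T.
rewrite -[X in 'C(X, j)]card_ord -card_draws mulr_natl -sumr_const.
apply: ler_sum => T; rewrite inE => /eqP cT.
apply: (le_trans (@union _ [in family (pair_choice S T)] _ (fun g E _ =>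
   in_out (twofold o T g) (outside o S T) E) _)) => [E c /exists_inP [g hg h]|].
  by exists g.
apply: (@le_trans _ _ (\sum_(g in family (pair_choice S T)) w)).
  apply: ler_sum => g gF; rewrite prob_in_out ?disjoint_twofold_outside //.
  by rewrite (card_twofold _ gF) card_outside cS cT.
rewrite sumr_const -[w *+ _]mulr_natl ler_wpM2r // -!natrX ler_nat.
rewrite -cS -[X in (_ ^ X)%N]cT.
exact: card_pair_choice.
Qed.

End UnionBounds.

(** * Asymptotics *)

From mathcomp Require Import all_classical all_reals all_analysis.
Import numFieldNormedType.Exports.

Section Estimates.
Variable R : realType.
Implicit Types (x p L w : R) (n k j K : nat).

(** A weak Stirling bound, by induction from [(1 + 1/k)^k <= e]. *)
Lemma expr_le_fact_expR k : (k%:R : R) ^+ k <= k`!%:R * expR k%:R.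
Proof.
elim: k => [|k IH]; first by rewrite expr0 fact0 mul1r expR0.
have [->|k0] := posnP k.
  by rewrite expr1 mul1r (le_trans _ (expR_ge1Dx _)) // lerDr.
have kR : (0 : R) < k%:R by rewrite ltr0n.
have step : (k.+1%:R : R) ^+ k <= k%:R ^+ k * expR 1.
  have -> : (k.+1%:R : R) = k%:R * (1 + k%:R^-1).
    by rewrite mulrDr mulr1 mulfV ?gt_eqF // -natr1.
  rewrite exprMn ler_wpM2l ?exprn_ge0 ?ler0n //.
  have -> : expR 1 = expR (k%:R^-1) ^+ k :> R.
    by rewrite -expRM_natl mulfV // gt_eqF.
  by apply: lerXn2r; rewrite ?nnegrE ?addr_ge0 ?invr_ge0 ?ler0n ?expR_ge0 ?expR_ge1Dx.
rewrite exprS factS natrM -natr1 expRD -!mulrA ler_wpM2l ?addr_ge0 ?ler0n //.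
rewrite natr1; apply: (le_trans step); rewrite mulrA ler_wpM2r ?expR_ge0 //.
Qed.

Lemma onem_exp_le p k : 0 <= p -> p <= 1 -> (1 - p) ^+ k <= expR (- (p * k%:R)).
Proof.
move=> p0 p1; rewrite mulrC -mulrN expRM_natl.
by apply: lerXn2r; rewrite ?nnegrE ?subr_ge0 ?expR_ge0 // expR_ge1Dx.
Qed.

Lemma expRN_le_inv x : 0 < x -> expR (- x) <= x^-1.
Proof.
move=> x0; rewrite expRN lef_pV2 ?posrE ?expR_gt0 //.
by apply: (le_trans _ (expR_ge1Dx _)); rewrite lerDr.
Qed.

Lemma bin_mul_fact_le n k : ('C(n, k) * k`! <= n ^ k)%N.
Proof.
rewrite bin_ffact; elim: k n => [|k IH] n; first by rewrite ffactn0.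
case: n => [|n]; first by rewrite ffact0n.
rewrite ffactSS expnS leq_mul //; apply: leq_trans (IH n) _.
by case: k {IH} => [|k]; rewrite ?expn0 ?leq_exp2r.
Qed.

Lemma violator_count n j :
  ('C(n, j.+1)%:R : R) * 'C(n, j)%:R * (j.+1%:R ^+ 2) ^+ j
  <= n%:R ^+ (2 * j).+1 * expR 2 ^+ j.+1.
Proof.
have f0 : (0 : R) < (j.+1)`!%:R by rewrite ltr0n fact_gt0.
(* After multiplying by the square of [(j+1)!], the binomials are at most powers of [n], and the
   powers of [j+1] are absorbed by two uses of the Stirling bound. *)
rewrite -(ler_pM2r (mulr_gt0 f0 f0)).
apply: (@le_trans _ _ (n%:R ^+ (2 * j).+1 * (j.+1%:R ^+ j.+1 * j.+1%:R ^+ j.+1))).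
  rewrite -!natrX -!natrM ler_nat.
  have h1 := bin_mul_fact_le n j.+1; have h2 := bin_mul_fact_le n j.
  have -> : ('C(n, j.+1) * 'C(n, j) * (j.+1 ^ 2) ^ j * ((j.+1)`! * (j.+1)`!) =
     ('C(n, j.+1) * (j.+1)`!) * ('C(n, j) * j`!) * (j.+1 ^ (2 * j)) * j.+1)%N.
    by rewrite -expnM [X in (_ * (_ * X))%N]factS; lia.
  have -> : (n ^ (2 * j).+1 * (j.+1 ^ j.+1 * j.+1 ^ j.+1) =
     n ^ j.+1 * n ^ j * j.+1 ^ (2 * j) * (j.+1 * j.+1))%N.
    by rewrite mul2n -addnn expnS !expnD !expnS; lia.
  by rewrite leq_mul ?leq_mul // leq_pmull.
rewrite -mulrA ler_wpM2l ?exprn_ge0 ?ler0n //.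
have -> : expR 2 ^+ j.+1 * ((j.+1)`!%:R * (j.+1)`!%:R) =
   ((j.+1)`!%:R * expR j.+1%:R) * ((j.+1)`!%:R * expR j.+1%:R) :> R.
  rewrite -expRM_natl mulr_natr mulr2n.
  by rewrite expRD; ring.
by apply: ler_pM; rewrite ?exprn_ge0 ?ler0n ?expr_le_fact_expR.
Qed.

(** With [L] the mean degree, [n^(2j+1) p^(2j) = n L^(2j)]. Since [2(j+1) <= n], the absent edges
    contribute at most [e^(-L)] times [e^(-L/2)] to the power [j], so the terms are dominated by a
    geometric progression. *)
Lemma violator_term n j p L : 0 <= p -> p <= 1 -> (2 * j.+1 <= n)%N ->
  L = p * n%:R ->
  2 * 'C(n, j.+1)%:R * 'C(n, j)%:R * (j.+1%:R ^+ 2) ^+ j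
     * (p ^+ (2 * j) * (1 - p) ^+ (j.+1 * (n - j)))
  <= 2 * expR 2 * (n%:R * expR (- L)) * (expR 2 * L ^+ 2 * expR (- (L / 2))) ^+ j.
Proof.
move=> p0 p1 len hL.
have e : (1 - p) ^+ (j.+1 * (n - j)) <= expR (- L) * expR (- (L / 2)) ^+ j.
  apply: (le_trans (onem_exp_le _ p0 p1)).
  rewrite -expRM_natl -expRD ler_expR natrM natrB; last lia.
  rewrite hL -natr1.
  have h : (2 : R) * (j%:R + 1) <= n%:R by rewrite natr1 -natrM ler_nat.
  have j0 : (0 : R) <= j%:R by rewrite ler0n.
  have : 0 <= p * j%:R * (n%:R - 2 * (j%:R + 1)).
    by rewrite !mulr_ge0 // subr_ge0.
  nra.
rewrite -!mulrA ler_pM2l // !mulrA -[leLHS]mulrA.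
apply: (le_trans (ler_pM _ _ (violator_count n j) (ler_wpM2l _ e))).
- by rewrite !mulr_ge0 ?exprn_ge0 ?ler0n.
- by rewrite mulr_ge0 ?exprn_ge0 ?subr_ge0.
- by rewrite exprn_ge0.
rewrite le_eqVlt; apply/orP; left; apply/eqP; 
move: (expR 2) (expR (- L)) (expR (- (L / 2))) => a b c.
by rewrite hL !exprMn !exprS mul2n -addnn !exprD; ring.
Qed.

Lemma geometric_half_le x K : 0 <= x -> x <= 2^-1 -> \sum_(j < K) x ^+ j <= 2.
Proof.
move=> x0 xh.
(* The right side is the exact partial sum for ratio 1/2, which lets the induction close. *)
suff : \sum_(j < K) x ^+ j <= 2 - 2 * 2^-1 ^+ K.
  by move/le_trans; apply; rewrite gerBl mulr_ge0 ?exprn_ge0 // invr_ge0.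
elim: K => [|K IH]; first by rewrite big_ord0 expr0 mulr1 subrr.
rewrite big_ord_recr /= exprS.
have : x ^+ K <= 2^-1 ^+ K by apply: lerXn2r; rewrite ?nnegrE.
lra.
Qed.

(** [e^(L/2) >= (L/8)^4 = (L/64)^2 L^2], and [L/64 >= 2 e^2] makes half of [(L/64)^2] exceed
    [e^2]. *)
Lemma square_expR_small L : 128 * expR 2 <= L ->
  expR 2 * L ^+ 2 * expR (- (L / 2)) <= 2^-1.
Proof.
move=> leL.
have e1 : 1 <= expR 2 :> R by have := @expR_ge1Dx R 2; lra.
have h4 : (L / 8) ^+ 4 <= expR (L / 2).
  have -> : L / 2 = 4%:R * (L / 8) by field.
  rewrite expRM_natl; apply: lerXn2r; rewrite ?nnegrE ?expR_ge0 //; first lra.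
  by apply: (le_trans _ (expR_ge1Dx _)); lra.
rewrite expRN ler_pdivrMr ?expR_gt0 //.
apply: (@le_trans _ _ (2^-1 * (L / 8) ^+ 4)); last by rewrite ler_wpM2l // invr_ge0.
have -> : 2^-1 * (L / 8) ^+ 4 = (L / 64) ^+ 2 / 2 * L ^+ 2 by field.
rewrite ler_wpM2r ?sqr_ge0 //.
have : 2 * expR 2 <= L / 64 by lra.
move: (L / 64) => t {h4} ht; nra.
Qed.

(** [K^2 >= n^2 / (4 d^2)] and [4 <= e^2] bound the term by the [n]-th power of the right side; its
    exponent is nonpositive and [n >= 1], so one factor suffices. *)
Lemma hole_term n K (d : nat) (a p w : R) : 0 <= p -> p <= 1 -> 0 <= a -> a <= 1 ->
  (0 < n)%N -> (n <= 2 * d * K)%N -> w <= p * n%:R ->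
  2 <= a / (4 * d%:R ^+ 2) * w ->
  4 ^+ n * (1 - p * a) ^+ (K * K) <= expR (2 - a / (4 * d%:R ^+ 2) * w).
Proof.
move=> p0 p1 a0 a1 n0 leK lew; set b := a / _ => lb.
have d0 : (0 < d)%N by case: d leK {b lb} => //; lia.
have dR : (0 : R) < d%:R by rewrite ltr0n.
have b0 : 0 <= b by rewrite divr_ge0 // mulr_ge0 ?exprn_ge0.
have h4 : 4 ^+ n <= expR 2 ^+ n :> R.
  apply: lerXn2r; rewrite ?nnegrE ?expR_ge0 //.
  have -> : (2 : R) = 2%:R * 1 by rewrite mulr1.
  rewrite expRM_natl; have := @expR_ge1Dx R 1; nra.
have h1 : (1 - p * a) ^+ (K * K) <= expR (- (b * w)) ^+ n.
  apply: (le_trans (onem_exp_le _ _ _)); first exact: mulr_ge0.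
    exact: mulr_ile1.
  rewrite -expRM_natl ler_expR mulrN lerN2 natrM /b [leLHS]mulrC.
  have h : (n%:R : R) <= 2 * d%:R * K%:R by rewrite -!natrM ler_nat.
  have hh : (n%:R : R) * n%:R <= 4 * d%:R ^+ 2 * (K%:R * K%:R).
    have := ler_pM (ler0n R n) (ler0n R n) h h; nra.
  apply: (@le_trans _ _ (a / (4 * d%:R ^+ 2) * (p * n%:R) * n%:R)).
    by rewrite ler_wpM2r // ler_wpM2l.
  have -> : a / (4 * d%:R ^+ 2) * (p * n%:R) * n%:R =
     p * a * ((n%:R * n%:R) / (4 * d%:R ^+ 2)) by field; rewrite gt_eqF.
  rewrite ler_wpM2l ?mulr_ge0 // ler_pdivrMr ?mulr_gt0 ?exprn_gt0 //.
  by rewrite [leRHS]mulrC.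
apply: (@le_trans _ _ (expR (2 - b * w) ^+ n)).
  rewrite expRD exprMn; apply: ler_pM => //; rewrite ?exprn_ge0 // subr_ge0.
  exact: mulr_ile1.
rewrite -expRM_natl ler_expR.
have : (1 : R) <= n%:R by rewrite ler1n.
nra.
Qed.

End Estimates.

(** * The bound for fixed [n] and the limit *)

(** The linear scale is [K = n %/ d]: [10 * q <= d] gives [10 * (q * K) <= n], and [d <= n] gives
    [n <= 2 * d * K]. The geometric series doubles the factor [2 * expR 2]. *)
Lemma prob_colored_pm_ge (R : realType) n q (p w : R) (alpha : 'I_q -> R)
    (m : 'I_q -> nat) d :
    0 <= p -> p <= 1 -> (forall i, 0 < alpha i) -> \sum_(i < q) alpha i = 1 ->
    (0 < q)%N -> (10 * q <= d)%N -> (d <= n)%N ->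
    (\sum_(i < q) m i)%N = n -> (forall i, 3 * (q * (n %/ d)) <= m i)%N ->
    w <= p * n%:R -> (forall i, 2 <= alpha i / (4 * d%:R ^+ 2) * w) ->
    128 * expR 2 <= p * n%:R ->
  1 - (\sum_(i < q) expR (2 - alpha i / (4 * d%:R ^+ 2) * w)
       + 4 * expR 2 * (n%:R * expR (- (p * n%:R))))
  <= colored_gnnp_prob p alpha (has_colored_pm m : {set edge n} -> _ -> bool).
Proof.
move=> p0 p1 a0 a1 q0 led len sm lem.
have d0 : (0 < d)%N by lia.
have n0 : (0 < n)%N by lia.
set K := (n %/ d)%N in lem *.
have K0 : (0 < K)%N by rewrite divn_gt0.
have dK : (K * d <= n)%N by apply: leq_trunc_div.
have ltn : (n < K.+1 * d)%N by apply: ltn_ceil.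
have le10 : (10 * (q * K) <= n)%N.
  by rewrite mulnA (leq_trans _ dK) // [leqRHS]mulnC leq_mul2r led orbT.
have le2K : (n <= 2 * d * K)%N.
  apply: (leq_trans (ltnW ltn)); rewrite [(2 * d)%N]mulnC -mulnA [leqLHS]mulnC.
  by rewrite leq_mul2l orbC; lia.
move=> lew la leL; rewrite probC // lerD2l lerN2.
apply: (@le_trans _ _ (colored_gnnp_prob (n := n) p alpha (color_hole K) +
    colored_gnnp_prob (n := n) p alpha (fun E _ => small_violator K E))).
  by apply: prob_or => // E c; apply: has_colored_pm_or.
apply: lerD.
  apply: (le_trans (prob_color_hole n p0 p1 a0 a1 K)); apply: ler_sum => i _.
  by apply: hole_term; rewrite ?alpha_le1 // ltW.
apply: (le_trans (prob_small_violator n p0 p1 a0 a1 K)).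
set L := p * n%:R in leL *.
pose x := expR 2 * L ^+ 2 * expR (- (L / 2)).
apply: (@le_trans _ _ (\sum_(j < K) 2 * expR 2 * (n%:R * expR (- L)) * x ^+ j)).
  apply: ler_sum => j _; apply: violator_term => //; apply: (leq_trans _ le10).
  by apply: leq_mul => //; apply: (leq_trans (ltn_ord j)); rewrite leq_pmull.
rewrite -big_distrr /=.
rewrite (_ : 4 * _ * _ = 2 * expR 2 * (n%:R * expR (- L)) * 2); last by ring.
rewrite ler_wpM2l ?mulr_ge0 ?expR_ge0 //.
apply: geometric_half_le; last exact: square_expR_small.
by rewrite !mulr_ge0 ?expR_ge0 ?sqr_ge0.
Qed.

(** [e^(n/2) >= (1 + n/4)^2 >= n]; used to check [p <= 1]. *)
Lemma ln_nat_le_half (R : realType) n : (0 < n)%N -> ln n%:R <= n%:R / 2 :> R.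
Proof.
move=> n0; have nR : (0 : R) < n%:R by rewrite ltr0n.
rewrite -ler_expR lnK ?posrE //.
have -> : (n%:R / 2 : R) = 2%:R * (n%:R / 4) by field.
rewrite expRM_natl; have := @expR_ge1Dx R (n%:R / 4).
set e := expR _ => he; have : 0 <= (n%:R / 4 - 1 : R) ^+ 2 by rewrite sqr_ge0.
have : 0 <= (e - (1 + n%:R / 4)) * (e + (1 + n%:R / 4)).
  by apply: mulr_ge0; lra.
nra.
Qed.

Local Open Scope classical_set_scope.

Theorem theorem1 (R : realType) (q : nat) (alpha : 'I_q -> R) (beta : R)
    (omega : nat -> R) (m : nat -> 'I_q -> nat)
    (hq : (1 <= q)%N)
    (halpha_gt0 : forall i : 'I_q, 0 < alpha i)
    (halpha_sum : \sum_(i < q) alpha i = 1)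
    (hbeta_gt0 : 0 < beta)
    (hbeta_lt : beta < 1 / q%:R)
    (homega_infty : omega n @[n --> \oo] --> +oo)
    (homega_o : omega =o_\oo (fun n : nat => ln (n%:R : R)))
    (hm : \forall n \near \oo,
       (\sum_(i < q) m n i)%N = n /\
       forall i : 'I_q, beta * n%:R <= (m n i)%:R) :
  colored_gnnp_prob (n := n) ((ln n%:R + omega n) / n%:R) alpha
    (has_colored_pm (m n)) @[n --> \oo] --> (1 : R).
Proof.
have qR : (1 : R) <= q%:R by rewrite ler1n.
have beta1 : beta < 1.
  by apply: (lt_le_trans hbeta_lt); rewrite ler_pdivrMr ?mul1r //; lra.
(* Chosen so that [10 q <= beta d]: this yields [10 q <= d] as [beta < 1], and
   [3 q (n %/ d) <= beta n <= m_i]. *)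
pose d := (Num.truncn (10 * q%:R / beta)).+1.
have hd : 10 * q%:R <= beta * d%:R.
  have := truncnS_gt (10 * q%:R / beta); rewrite -/d ltr_pdivrMr // => h.
  by rewrite [leRHS]mulrC ltW.
have led : (10 * q <= d)%N.
  rewrite -(ler_nat R) natrM; apply: (le_trans hd).
  by rewrite ler_piMl // ltW.
have dR : (0 : R) < d%:R by rewrite ltr0n.
have omega_ge A : \forall n \near \oo, A <= omega n by move: A; apply/cvgryPge.
apply/cvgrPdist_le => eps eps0.
pose b i := alpha i / (4 * d%:R ^+ 2).
have b0 i : 0 < b i by rewrite divr_gt0 // mulr_gt0 // exprn_gt0.
(* This threshold gives [b i * omega n - 2 >= 2 q / eps], so each of the [q] hole terms is at most
   [eps / (2 q)]. *)
have near_b : \forall n \near \oo, forall i, (2 + 2 * q%:R / eps) / b i <= omega n.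
  by apply: filter_forall => i; apply: omega_ge.
have near_o : \forall n \near \oo, `|omega n| <= 1 * `|ln n%:R|.
  by move: homega_o => /eqoP /(_ 1 ltr01).
near=> n.
have len : (d <= n)%N by near: n; exact: nbhs_infty_ge.
have n0 : (0 < n)%N by apply: leq_trans len.
have nR : (1 : R) <= n%:R by rewrite ler1n.
have [sm lem] : (\sum_(i < q) m n i)%N = n /\
    forall i : 'I_q, beta * n%:R <= (m n i)%:R by near: n.
have hb : forall i, (2 + 2 * q%:R / eps) / b i <= omega n by near: n.
have ho : `|omega n| <= 1 * `|ln n%:R| by near: n.
have hw1 : 128 * expR 2 <= omega n by near: n; exact: omega_ge.
have hw2 : 8 * expR 2 / eps <= omega n by near: n; exact: omega_ge.
have e1 : 1 <= expR 2 :> R by have := @expR_ge1Dx R 2; lra.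
have ln0 : 0 <= ln n%:R :> R by rewrite ln_ge0.
have ho' : omega n <= ln n%:R.
  by move: ho; rewrite mul1r [X in _ <= X]ger0_norm // ler_norml => /andP [].
have w0 : 0 < omega n by lra.
set p := (ln n%:R + omega n) / n%:R.
have pL : p * n%:R = ln n%:R + omega n by rewrite divfK // gt_eqF //; lra.
have p0 : 0 <= p by rewrite divr_ge0 ?addr_ge0 // ltW.
(* [omega = o(log n)] gives [omega n <= ln n], hence [p n <= 2 ln n <= n]. *)
have p1 : p <= 1.
  rewrite ler_pdivrMr ?mul1r; last by lra.
  by have := @ln_nat_le_half R n n0; lra.
have lem' i : (3 * (q * (n %/ d)) <= m n i)%N.
  rewrite -(ler_nat R); apply: le_trans (lem i).
  apply: (@le_trans _ _ (beta * (n %/ d * d)%:R)); last first.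
    by rewrite ler_wpM2l ?ler_nat ?leq_trunc_div // ltW.
  rewrite !natrM; have : (0 : R) <= (n %/ d)%:R by rewrite ler0n.
  nra.
have hb' i : 2 * q%:R / eps <= b i * omega n - 2.
  by have := hb i; rewrite ler_pdivrMr // mulrC; lra.
have qe : 0 < 2 * q%:R / eps by rewrite divr_gt0 //; lra.
have := @prob_colored_pm_ge R n q p (omega n) alpha (m n) d p0 p1 halpha_gt0
  halpha_sum hq led len sm lem'.
rewrite pL => h.
have {}h : 1 - (\sum_(i < q) expR (2 - b i * omega n)
    + 4 * expR 2 * (n%:R * expR (- (ln n%:R + omega n)))) <=
    colored_gnnp_prob (n := n) p alpha (has_colored_pm (m n)).
  by apply: h => [|i|]; [lra | have := hb' i; rewrite /b; lra | lra].
have holes : \sum_(i < q) expR (2 - b i * omega n) <= eps / 2.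
  apply: (@le_trans _ _ (\sum_(i < q) (2 * q%:R / eps)^-1)).
    apply: ler_sum => i _; rewrite -opprB; apply: (le_trans (expRN_le_inv _)).
      by have := hb' i; lra.
    by rewrite lef_pV2 ?posrE // (lt_le_trans qe).
  rewrite sumr_const card_ord -mulr_natr le_eqVlt; apply/orP; left; apply/eqP.
  by field; rewrite !gt_eqF //; lra.
(* The factor [n] cancels against [e^(-ln n)], leaving [e^(-omega) <= 1 / omega]. *)
have viols : 4 * expR 2 * (n%:R * expR (- (ln n%:R + omega n))) <= eps / 2.
  rewrite opprD [expR (- _ - _)]expRD [expR (- ln _)]expRN lnK ?posrE; last by lra.
  rewrite [n%:R * _]mulrA mulfV ?mul1r; last by rewrite gt_eqF //; lra.
  apply: (@le_trans _ _ (4 * expR 2 * (omega n)^-1)).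
    by rewrite ler_wpM2l ?expRN_le_inv //; lra.
  move: hw2; rewrite !ler_pdivrMr //; lra.
have le1 := prob_le1 p0 p1 halpha_gt0 halpha_sum
  (has_colored_pm (n := n) (m n)).
by rewrite ger0_norm ?subr_ge0 //; lra.
Unshelve. all: by end_near.
Qed.
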